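(* Let $P$ be a poset with $|P|=d$ finite. Then $$\overline{\mathcal{L}(P)\,\mathcal{U}(P)}=\mathbb{C}^{P\times P}$$ (closure in the norm topology) if and only if $P$ is linearly ordered.
   Context: Matrices in $\mathbb{C}^{P\times P}$ have rows and columns indexed by the finite set $P$. For a finite poset $P$, $$\mathcal{L}(P):=\{L\in\mathbb{C}^{P\times P}\mid L_{xy}=0\text{ unless }y\le x\},\qquad \mathcal{U}(P):=\{U\in\mathbb{C}^{P\times P}\mid U_{xy}=0\text{ unless }x\le y\},$$ and $\mathcal{L}(P)\,\mathcal{U}(P)=\{LU\mid L\in\mathcal{L}(P),U\in\mathcal{U}(P)\}$. A poset is linearly ordered if any two of its elements are comparable. *)

(* Defs.v *)
From HB Require Import structures.
From mathcomp Require Import all_boot all_order all_algebra.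
From mathcomp Require Import all_classical all_reals all_analysis.
From mathcomp Require Import complex.

Set Implicit Arguments.
Unset Strict Implicit.
Unset Printing Implicit Defensive.

Import Order.TTheory GRing.Theory Num.Theory.
Import numFieldNormedType.Exports.

Local Open Scope classical_set_scope.
Local Open Scope ring_scope.

(* Packing R[i] as a numClosedFieldType gives it, by the generic instances of
   numFieldNormedType, the topology of its modulus; 'M[cplx R]_n then carries
   the topology of its max norm. *)
Definition cplx (R : realType) : numClosedFieldType := R[i]%C.

(* A P x P matrix is a square matrix of size #|P| whose (x, y) entry is the one
   at position (enum_rank x, enum_rank y). *)
Definition poset_lower (K : pzRingType) (disp : Order.disp_t)
    (P : finPOrderType disp) : set 'M[K]_#|P| :=
  [set L : 'M[K]_#|P| |
    forall x y : P, ~~ (y <= x)%O -> L (enum_rank x) (enum_rank y) = 0].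

Definition poset_upper (K : pzRingType) (disp : Order.disp_t)
    (P : finPOrderType disp) : set 'M[K]_#|P| :=
  [set U : 'M[K]_#|P| |
    forall x y : P, ~~ (x <= y)%O -> U (enum_rank x) (enum_rank y) = 0].

Definition poset_LU (K : pzRingType) (disp : Order.disp_t)
    (P : finPOrderType disp) : set 'M[K]_#|P| :=
  [set L *m U | L in @poset_lower K disp P & U in @poset_upper K disp P].

Definition linearly_ordered (disp : Order.disp_t) (P : finPOrderType disp) :=
  forall x y : P, (x >=< y)%O.

Arguments poset_lower K {disp} P.
Arguments poset_upper K {disp} P.
Arguments poset_LU K {disp} P.

(* Main.v *)
Require Import Defs.
From HB Require Import structures.
From mathcomp Require Import all_boot all_order all_algebra.
From mathcomp Require Import all_classical all_reals all_analysis.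

Import Order.TTheory GRing.Theory Num.Theory.
Import numFieldNormedType.Exports.

Local Open Scope classical_set_scope.
Local Open Scope ring_scope.

(** If x and y are incomparable, let I be the set of their common lower bounds.
For L lower and U upper, the submatrix of L U with rows I, x and columns I, y
factors through I, so its determinant vanishes; this closed condition
excludes some matrices.  Conversely, if P is linearly ordered, the LU
factorization is computed by Gaussian elimination, where a vanishing pivot is
first replaced by a small nonzero one. *)

Lemma continuous_mxsub_det (K : numFieldType) (n k : nat)
    (f g : 'I_k -> 'I_n) :
  continuous (fun A : 'M[K]_n => \det (mxsub f g A)).
Proof.
rewrite /determinant; apply: continuous_big => [|s _ A].
  exact: add_continuous.
apply: (@cvgM _ _ (nbhs A)); first exact: cvg_cst.
apply: continuous_big => [|i _ {}A]; first exact: mul_continuous.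
under eq_fun do rewrite mxE.
exact: coord_continuous.
Qed.

Lemma exists_mxsub1 (K : pzRingType) (n k : nat) (f g : 'I_k -> 'I_n) :
  injective f -> injective g -> exists A : 'M[K]_n, mxsub f g A = 1%:M.
Proof.
move=> f_inj g_inj.
exists (\matrix_(i, j) [exists l, (f l == i) && (g l == j)]%:R).
apply/matrixP => i j; rewrite !mxE; congr (nat_of_bool _)%:R.
apply/existsP/eqP => [[l /andP[/eqP/f_inj <- /eqP/g_inj <-]] //|<-].
by exists i; rewrite !eqxx.
Qed.

Lemma det_mulmx_wide (F : fieldType) (n k : nat) (A : 'M[F]_(n, k))
    (B : 'M[F]_(k, n)) :
  (k < n)%N -> \det (A *m B) = 0.
Proof.
move=> ltkn; apply/eqP; apply: contraTT ltkn => det_neq0; rewrite -leqNgt.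
have /mxrank_unit <- : A *m B \in unitmx by rewrite unitmxE unitfE.
exact: mulmx_max_rank.
Qed.

Lemma poset_LU_mxsub_det0 (F : fieldType) (disp : Order.disp_t)
    (P : finPOrderType disp) (x y : P) (A : 'M[F]_#|P|) :
  poset_LU F P A ->
  let s := enum [pred c : P | (c <= x)%O && (c <= y)%O] in
  let row_of (z : P) (i : 'I_(size s).+1) := enum_rank (nth z (rcons s z) i) in
  \det (mxsub (row_of x) (row_of y) A) = 0.
Proof.
move=> [L L_lower [U U_upper <-]] s row_of.
have s_mem c : (c \in s) = (c <= x)%O && (c <= y)%O by rewrite mem_enum.
pose h (l : 'I_(size s)) := enum_rank (nth x s l).
suff -> : mxsub (row_of x) (row_of y) (L *m U) =
    mxsub (row_of x) h L *m mxsub h (row_of y) U by exact: det_mulmx_wide.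
apply/matrixP => i j; rewrite !mxE.
rewrite (reindex _ (onW_bij _ (@enum_rank_bij P))) /=.
rewrite (bigID (mem s)) /= [X in _ + X]big1 ?addr0 => [|c].
  under [RHS]eq_bigr do rewrite !mxE.
  by rewrite -big_uniq ?enum_uniq //= (big_nth x) big_mkord.
rewrite s_mem => cNs.
have below_z z (l : 'I_(size s).+1) : (forall d, d \in s -> (d <= z)%O) ->
    (c <= nth z (rcons s z) l)%O -> (c <= z)%O.
  move=> s_z /le_trans; apply.
  have := mem_nth z (_ : l < size (rcons s z))%N.
  by rewrite size_rcons ltn_ord mem_rcons inE => /(_ isT) /predU1P[-> //|/s_z].
have [cx|ncx] := boolP (c <= nth x (rcons s x) i)%O; last first.
  by rewrite L_lower ?mul0r.
have [cy|ncy] := boolP (c <= nth y (rcons s y) j)%O; last first.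
  by rewrite U_upper ?mulr0.
case/negP: cNs; apply/andP; split.
  by apply: below_z cx => d; rewrite s_mem => /andP[].
by apply: below_z cy => d; rewrite s_mem => /andP[].
Qed.

Lemma closure_LU_neq_setT (K : numFieldType) (disp : Order.disp_t)
    (P : finPOrderType disp) (x y : P) :
  ~~ (x >=< y)%O -> closure (poset_LU K P) <> [set: 'M[K]_#|P|].
Proof.
move=> ncxy closureT.
set s := enum [pred c : P | (c <= x)%O && (c <= y)%O].
pose row_of (z : P) (i : 'I_(size s).+1) := enum_rank (nth z (rcons s z) i).
have det0 A : poset_LU K P A -> \det (mxsub (row_of x) (row_of y) A) = 0.
  by move=> LU_A; exact: poset_LU_mxsub_det0.
have row_inj z : z \notin s -> injective (row_of z).
  move=> zNs i j /enum_rank_inj /eqP.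
  rewrite nth_uniq ?size_rcons ?rcons_uniq ?zNs ?enum_uniq //.
  by move=> /eqP/val_inj.
have [xNs yNs] : x \notin s /\ y \notin s.
  move: ncxy; rewrite !mem_enum !inE !lexx andbT /= negb_or.
  by case/andP.
have [B B1] := exists_mxsub1 K _ _ _ _ (row_inj x xNs) (row_inj y yNs).
pose minor (A : 'M[K]_#|P|) := \det (mxsub (row_of x) (row_of y) A).
have minor_closed : closed (minor @^-1` [set 0]).
  apply: preimage_closed => [A _|]; first exact: continuous_mxsub_det.
  exact/accessible_closed_set1/hausdorff_accessible/norm_hausdorff.
have : closure (poset_LU K P) B by rewrite closureT.
have /closureS : poset_LU K P `<=` minor @^-1` [set 0] by [].
move=> /[apply]; rewrite -(closure_id _).1 // /preimage /minor /= B1 det1.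
by apply/eqP; rewrite oner_eq0.
Qed.

Lemma trig_LU_approx (K : numFieldType) (n : nat) (A : 'M[K]_n) (e : K) :
  0 < e -> exists L U : 'M[K]_n, [/\ is_trig_mx L, is_trig_mx U^T &
    forall i j, `|A i j - (L *m U) i j| < e].
Proof.
move=> e_gt0; elim: n A => [|n IHn].
  by exists 0, 0; split; rewrite ?trmx0 ?mx0_is_trig // => -[].
rewrite -[n.+1]/(1 + n)%N => A.
have [a a_neq0 a_near] : exists2 a, a != 0 & `|A ord0 ord0 - a| < e.
  have [->|A00_neq0] := eqVneq (A ord0 ord0) 0; last first.
    by exists (A ord0 ord0); rewrite ?subrr ?normr0.
  have e2_gt0 : 0 < e / 2 by rewrite divr_gt0 ?ltr0n.
  exists (e / 2); first by rewrite gt_eqF.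
  by rewrite sub0r normrN gtr0_norm // ltr_pdivrMr ?ltr_pMr ?ltr1n.
pose b := ursubmx A; pose c := dlsubmx A.
have [L [U [L_trig U_trig LU_near]]] := IHn (drsubmx A - a^-1 *: (c *m b)).
exists (block_mx 1%:M 0 (a^-1 *: c) L), (block_mx a%:M b 0 U).
rewrite tr_block_mx !is_trig_block_mx //= trmx0 !eqxx L_trig U_trig.
rewrite !mx11_is_trig.
split=> // i j.
rewrite -{1}[A]submxK mulmx_block !mul1mx !mul0mx !addr0.
rewrite mulmx0 addr0 mul_mx_scalar scalerA mulfV // scale1r.
have [i' ->|i' ->] := split_ordP i; have [j' ->|j' ->] := split_ordP j;
  rewrite ?block_mxEul ?block_mxEur ?block_mxEdl ?block_mxEdr ?subrr ?normr0 //.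
- by rewrite !ord1 !mxE eqxx lshift0.
- rewrite -scalemxAl [X in _ - X]mxE opprD addrA.
  by have := LU_near i' j'; rewrite [X in X - _]mxE [X in _ + X - _]mxE.
Qed.

Lemma linear_order_rank (disp : Order.disp_t) (P : finPOrderType disp) :
  linearly_ordered P -> exists r : P -> 'I_#|P|,
    forall x y, (r x <= r y)%N = (x <= y)%O.
Proof.
move=> P_lin.
have r_lt (x : P) : (#|[set z | (z < x)%O]%SET| < #|P|)%N.
  rewrite -cardsT proper_card //; apply/properP.
  by split; [exact: finset.subsetT | exists x; rewrite !inE ?ltxx].
exists (fun x => Ordinal (r_lt x)) => x y /=.
have r_homo u v : (u < v)%O ->
    (#|[set z | (z < u)%O]%SET| < #|[set z | (z < v)%O]%SET|)%N.
  move=> ltuv; apply/proper_card/properP; split.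
    by apply/fintype.subsetP => z; rewrite !inE => /lt_trans; apply.
  by exists u; rewrite !inE ?ltxx.
have [ltxy|ltyx|->] := comparable_ltgtP (P_lin x y); last exact: leqnn.
  exact/ltnW/r_homo.
by apply/negbTE; rewrite -ltnNge r_homo.
Qed.

Lemma linear_LU_approx (K : numFieldType) (disp : Order.disp_t)
    (P : finPOrderType disp) (A : 'M[K]_#|P|) (e : K) :
  linearly_ordered P -> 0 < e ->
  exists2 B, poset_LU K P B & forall i j, `|A i j - B i j| < e.
Proof.
move=> P_lin e_gt0; have [r r_le] := linear_order_rank _ _ P_lin.
pose s (i : 'I_#|P|) := r (enum_val i).
have s_inj : injective s.
  move=> i j eq_s; apply/enum_val_inj/le_anti.
  by rewrite -!r_le -/(s i) eq_s leqnn.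
pose t := invF s_inj.
have [L [U [/is_trig_mxP L_trig /is_trig_mxP U_trig LU_near]]] :=
  trig_LU_approx K #|P| (mxsub t t A) e e_gt0.
exists (mxsub s s L *m mxsub s s U) => [|i j].
  exists (mxsub s s L) => [x y|].
    by rewrite -r_le -ltnNge mxE /s !enum_rankK; exact: L_trig.
  exists (mxsub s s U) => // x y.
  rewrite -r_le -ltnNge mxE /s !enum_rankK => /U_trig.
  by rewrite mxE.
have := LU_near (s i) (s j); rewrite !mxE /t !invF_f.
congr (`|_ - _| < _); rewrite (reindex s) /=; last exact/onW_bij/injF_bij.
by apply: eq_bigr => l _; rewrite !mxE.
Qed.

Theorem lemma3 (R : realType) (disp : Order.disp_t) (P : finPOrderType disp) :
  closure (poset_LU (cplx R) P) = [set: 'M[cplx R]_#|P|] <-> linearly_ordered P.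
Proof.
split=> [closureT x y|P_lin].
  by apply: contraPT closureT; exact: closure_LU_neq_setT.
apply/seteqP; split=> // A _ V /nbhs_ballP[e e_gt0 ball_V].
have [B LU_B AB_near] := linear_LU_approx _ _ _ A e P_lin e_gt0.
exists B; split=> //; apply: ball_V.
by split=> // i j; rewrite -ball_normE; exact: AB_near.
Qed.
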